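(* Let $\Gamma$ be a transitive digraph on $n$ vertices with vertex set $V$ and edge set $E$. If $w(\Gamma) > (3/4)n^2$, then there exists a transitive digraph $\Gamma'$ on $n$ vertices such that $w(\Gamma) = w(\Gamma')$ and $\Gamma'$ has at least one mother vertex.
   Context: Digraphs are finite directed graphs without loops; an edge is an ordered pair $(\alpha,\beta)$ of distinct vertices. A digraph is transitive if whenever $(\alpha,\beta)$ and $(\beta,\gamma)$ are edges with $\alpha\neq\gamma$, then $(\alpha,\gamma)$ is an edge. A reachable pair of a digraph $\Gamma$ is an ordered pair $(\alpha,\beta)$ of (not necessarily distinct) vertices such that there is a directed path (possibly of length $0$) from $\alpha$ to $\beta$. The weight $w(\Gamma)$ is the number of reachable pairs of $\Gamma$; for a transitive digraph on $n$ vertices this equals $n$ plus the number of edges. In a transitive digraph, a mother vertex is a vertex $\alpha$ such that $(\alpha,\beta)$ is an edge for every vertex $\beta\neq\alpha$. *)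

(* Defs.v *)
From mathcomp Require Import all_boot.

Set Implicit Arguments.
Unset Strict Implicit.
Unset Printing Implicit Defensive.

Record digraph := Digraph {
  vertex : finType;
  edge : rel vertex;
  edge_irrefl : irreflexive edge
}.

(* Since [edge] is irreflexive, [transitive (edge G)] would also forbid pairs
   of mutually adjacent vertices: the side condition [a != c] is essential. *)
Definition transitive_digraph (G : digraph) : Prop :=
  forall a b c : vertex G, edge a b -> edge b c -> a != c -> edge a c.

(* [connect] includes paths of length 0. *)
Definition reachable_pairs (G : digraph) : {set vertex G * vertex G} :=
  [set p | connect (@edge G) p.1 p.2].

Definition weight (G : digraph) : nat := #|reachable_pairs G|.

Definition mother_vertex (G : digraph) (a : vertex G) : Prop :=
  forall b : vertex G, b != a -> edge a b.

(* Main.v *)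
(* Reachability is a preorder, and more than three quarters of all pairs being
   related forces one of its equivalence classes K to contain more than half of
   the vertices.  Let e be the number of vertices incomparable to K, so that
   e < #|K|, and make some K1 <= K with #|K| - e elements lie below everything,
   keeping the preorder on the complement of K1.  Each element of K1 was in
   n + #|K| - e relations with the n vertices, counting both directions; the
   incoming ones from K1 are #|K1| = #|K| - e of these, which leaves n.  It is
   now related to all n vertices and to it only those of K1 are, which again
   leaves n, so the weight is unchanged. *)
Require Import Defs.
From mathcomp Require Import all_boot all_order all_algebra.
From mathcomp Require Import zify lra.

Import Order.TTheory GRing.Theory Num.Theory.

Section Preorder.
Local Open Scope nat_scope.
Variables (T : finType) (r : rel T).
Hypotheses (r_refl : reflexive r) (r_trans : transitive r).

Definition eqclass (v : T) : {set T} := [set y | r v y && r y v].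
Definition incomparable (v : T) : {set T} := [set y | ~~ r v y && ~~ r y v].

Lemma card_rel (s : rel T) : #|[set p | s p.1 p.2]| = \sum_x \sum_y s x y.
Proof.
rewrite pair_big /= -sum1_card big_mkcond /=.
by apply: eq_bigr => p _; rewrite inE; case: (s _ _).
Qed.

Lemma sum_nat_of_mem (A : {set T}) : \sum_y (y \in A) = #|A|.
Proof.
by rewrite -sum1_card [RHS]big_mkcond; apply: eq_bigr => y _; case: (y \in A).
Qed.

Lemma sum_nat_of_true : \sum_(y : T) 1 = #|T|.
Proof. by rewrite sum_nat_const muln1. Qed.

(** Counting each pair together with its reverse, [r x y + r y x] is at most 1, plus 1 more if [y]
    is equivalent to [x]. Hence twice the number of related pairs is at most the sum over [x] of
    [#|T| + #|eqclass x|], and classes of at most half the vertices would bound each term by 3/2 of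
    [#|T|]. *)
Lemma large_eqclass :
  3 * #|T| ^ 2 < 4 * \sum_x \sum_y r x y -> exists v, #|T| < 2 * #|eqclass v|.
Proof.
move=> w_gt; apply/existsP; apply: contraLR w_gt; rewrite negb_exists -leqNgt.
move/forallP=> class_le.
have dbl : 2 * (\sum_x \sum_y r x y) <= \sum_x (#|T| + #|eqclass x|).
  rewrite mul2n -addnn [X in X + _]exchange_big /= -big_split /=.
  apply: leq_sum => x _; rewrite -big_split -sum_nat_of_true -sum_nat_of_mem.
  rewrite -big_split /=.
  by apply: leq_sum => y _; rewrite inE; case: (r x y); case: (r y x).
have sum_le : 2 * (\sum_x (#|T| + #|eqclass x|)) <= #|T| * (3 * #|T|).
  rewrite big_distrr /= -sum_nat_const; apply: leq_sum => x _.
  by have := class_le x; rewrite -leqNgt mulnDr; move: #|eqclass x| #|T| => c m; lia.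
rewrite -mulnn [leqRHS]mulnCA -[4]/(2 * 2) -mulnA (leq_trans _ sum_le) //.
by rewrite leq_pmul2l.
Qed.

Definition bottom_rel (K1 : {set T}) : rel T :=
  fun x y => (x \in K1) || ((y \notin K1) && r x y).

Lemma bottom_rel_refl K1 : reflexive (bottom_rel K1).
Proof. by move=> x; rewrite /bottom_rel r_refl andbT orbN. Qed.

(** A chain starting outside [K1] can never enter it, so there only [r] matters. *)
Lemma bottom_rel_trans K1 : transitive (bottom_rel K1).
Proof.
move=> y x z; rewrite /bottom_rel; case: (x \in K1) => //=.
by move=> /andP[/negPf-> rxy] /andP[-> ryz]; apply: r_trans ryz.
Qed.

Lemma card_bottom_rel v (K1 : {set T}) :
  K1 \subset eqclass v -> #|K1| + #|incomparable v| = #|eqclass v| ->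
  \sum_x \sum_y bottom_rel K1 x y = \sum_x \sum_y r x y.
Proof.
move=> /subsetP K1_sub card_K1.
have K1E x : x \in K1 -> r v x /\ r x v.
  by move=> /K1_sub; rewrite inE => /andP.
rewrite (bigID (mem K1)) [RHS](bigID (mem K1)) /=.
have -> : \sum_(x in K1) \sum_y bottom_rel K1 x y = #|K1| * #|T|.
  rewrite -sum_nat_const; apply: eq_bigr => x xK1.
  by rewrite -sum_nat_of_true; apply: eq_bigr => y _; rewrite /bottom_rel xK1.
have -> : \sum_(x in K1) \sum_y r x y = #|K1| * \sum_y r v y.
  rewrite -sum_nat_const; apply: eq_bigr => x /K1E[rvx rxv].
  by apply: eq_bigr => y _; congr nat_of_bool; apply/idP/idP; apply: r_trans.
have -> : \sum_(x | x \notin K1) \sum_y bottom_rel K1 x y =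
          \sum_(x | x \notin K1) \sum_(y | y \notin K1) r x y.
  apply: eq_bigr => x /negPf xK1; rewrite [RHS]big_mkcond; apply: eq_bigr => y _.
  by rewrite /bottom_rel xK1; case: (y \in K1).
have -> : \sum_(x | x \notin K1) \sum_y r x y =
          #|K1| * (\sum_(x | x \notin K1) r x v) +
          \sum_(x | x \notin K1) \sum_(y | y \notin K1) r x y.
  rewrite -sum_nat_const [X in _ = X + _]exchange_big -big_split.
  apply: eq_bigr => x _; rewrite [LHS](bigID (mem K1)) /=; congr (_ + _).
  apply: eq_bigr => y /K1E[rvy ryv].
  by congr nat_of_bool; apply/idP/idP => rx; apply: r_trans rx _.
(* The pairs avoiding [K1] cancel. As elements of [K1] have the same relations as [v], it remains to
   see that the successors of [v] and its predecessors outside [K1] number [#|T|] in total. *)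
rewrite addnA -mulnDr; congr (_ * _ + _).
have in_v : \sum_y r y v = #|K1| + \sum_(y | y \notin K1) r y v.
  rewrite (bigID (mem K1)) /= -sum1_card; congr (_ + _).
  by apply: eq_bigr => y /K1E[_ ->].
(* Each [y] contributes 2 to both sides if equivalent to [v], and 1 otherwise. *)
have both_v : \sum_y r v y + \sum_y r y v + #|incomparable v|
              = #|T| + #|eqclass v|.
  rewrite -!sum_nat_of_mem -sum_nat_of_true -!big_split /=; apply: eq_bigr => y _.
  by rewrite !inE; case: (r v y); case: (r y v).
move: in_v both_v card_K1; move: #|eqclass v| #|incomparable v| #|K1| #|T|; lia.
Qed.

(** The two sets are disjoint. When the class fills more than half of [T], this makes it strictly
    larger than [incomparable v], so that [K1] is nonempty. *)
Lemma card_incomparable v : #|eqclass v| + #|incomparable v| <= #|T|.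
Proof.
rewrite -!sum_nat_of_mem -sum_nat_of_true -big_split /=; apply: leq_sum => y _.
by rewrite !inE; case: (r v y); case: (r y v).
Qed.

End Preorder.

Lemma subset_of_card (T : finType) (A : {set T}) k :
  (k <= #|A|)%N -> exists2 B : {set T}, B \subset A & #|B| = k.
Proof.
move=> k_le; exists [set x in take k (enum A)].
  by apply/subsetP => x; rewrite inE => /mem_take; rewrite mem_enum.
rewrite cardsE (card_uniqP _) ?take_uniq ?enum_uniq // size_take_min -cardE.
exact/minn_idPl.
Qed.

Section DigraphOfPreorder.
Variables (T : finType) (r : rel T).
Hypotheses (r_refl : reflexive r) (r_trans : transitive r).

Definition preorder_edge : rel T := fun x y => (x != y) && r x y.

Lemma preorder_edge_irrefl : irreflexive preorder_edge.
Proof. by move=> x; rewrite /preorder_edge eqxx. Qed.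

Definition preorder_digraph : digraph := Digraph preorder_edge_irrefl.

Lemma preorder_digraph_transitive : transitive_digraph preorder_digraph.
Proof.
move=> a b c /andP[_ rab] /andP[_ rbc] ac; apply/andP; split=> //.
exact: r_trans rbc.
Qed.

(** Paths of length 0 restore the diagonal that [preorder_edge] drops, and transitivity of [r]
    contracts longer paths. *)
Lemma connect_preorder_edge : connect preorder_edge =2 r.
Proof.
move=> x y; apply/idP/idP => [/connectP[p]|rxy]; last first.
  by have [->|xy] := eqVneq x y; rewrite ?connect0 // connect1 // /preorder_edge xy.
elim: p x => [|z p IHp] x /=; first by move=> _ ->.
by move=> /andP[/andP[_ rxz] pth] lst; apply: r_trans (IHp _ pth lst).
Qed.

Lemma weight_preorder_digraph :
  weight preorder_digraph = (\sum_x \sum_y r x y)%N.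
Proof.
rewrite /weight -card_rel; apply: eq_card => p.
by rewrite !inE -connect_preorder_edge.
Qed.

End DigraphOfPreorder.

Local Open Scope ring_scope.

Theorem theorem1p3 (n : nat) (G : digraph) (card_G : #|vertex G| = n)
    (trans_G : transitive_digraph G)
    (weight_G : 3 / 4 * n%:R ^+ 2 < (weight G)%:R :> rat) :
  exists G' : digraph,
    [/\ #|vertex G'| = n, transitive_digraph G', weight G = weight G'
      & exists a : vertex G', mother_vertex a].
Proof.
pose r := connect (@edge G).
have r_refl : reflexive r by exact: connect0.
have r_trans : transitive r by exact: connect_trans.
have wE : weight G = (\sum_x \sum_y r x y)%N by rewrite -card_rel.
have [v v_large] : exists v, (#|vertex G| < 2 * #|eqclass _ r v|)%N.
  apply: large_eqclass; rewrite -wE card_G -(ltr_nat rat) natrM natrX natrM.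
  by lra.
have card_inc := card_incomparable _ r v.
have [K1 K1_sub card_K1] := subset_of_card _ _ _
  (leq_subr #|incomparable _ r v| #|eqclass _ r v|).
have [a aK1] : exists a, a \in K1 by apply/card_gt0P; rewrite card_K1; move: v_large card_inc;
  move: #|eqclass _ r v| #|incomparable _ r v| #|vertex G|; lia.
exists (preorder_digraph _ (bottom_rel _ r K1)); split=> //.
- by apply: preorder_digraph_transitive; apply: bottom_rel_trans.
- rewrite weight_preorder_digraph; last exact: bottom_rel_trans.
    (* The truncated subtraction defining the size of [K1] is exact, again because the class of [v]
       is the larger set. *)
    rewrite (card_bottom_rel _ r r_trans v K1) // card_K1 subnK //.
    move: v_large card_inc.
    move: #|eqclass _ r v| #|incomparable _ r v| #|vertex G|; lia.
  exact: bottom_rel_refl.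
- exists a => b ba; apply/andP; split; first by rewrite eq_sym.
  by rewrite /bottom_rel aK1.
Qed.
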